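(* Let a static electrogravitational field be asymptotically flat and of Majumdar-type, i.e. $e^{\omega}=(C+\phi)^2$ throughout the space-time for some constant $C$. Then its total mass $m$ and total charge $q$ satisfy $m=|q|$.
   Context: Greek indices run over $1,\dots,4$, Latin indices over $1,2,3$. The static metric is $ds^2=g_{ij}dx^idx^j-e^{\omega}dt^2$ with $g_{ij},\omega$ depending only on the spatial coordinates $x^i$, and $x^4=t$. The timelike hypersurface-orthogonal Killing vector is $\xi^\mu=\delta^\mu_4$. The field is purely electric: $F_{i4}=\phi_{,i}$, $F_{ij}=0$, with electric potential $\phi=\phi(x^i)$. The metric and $\phi$ satisfy the Einstein–Maxwell equations with some matter tensor and charge density. Total mass: $$m=\lim_{R\to\infty}\frac1{4\pi}\int_{S_R}\frac{\xi^\mu}{(-\xi_\alpha\xi^\alpha)^{1/2}}\nabla_\mu\xi_\nu N^\nu\,dA .$$ Total charge: $$q=\lim_{R\to\infty}\frac1{4\pi}\int_{S_R}F_{\mu\nu}N^\mu t^\nu\,dA .$$ Here $S_R$ is a sphere of radius $R$ in the hypersurface orthogonal to $\xi^\mu$, $N^\mu$ is the outward pointing normal to $S_R$ which is orthogonal to $\xi^\mu$, $t^\mu$ is the unit normal to the volume enclosed by $S_R$, and $dA$ is the area element induced on $S_R$ by $g_{ij}$. In these coordinates $m=\lim_{R\to\infty}\frac1{8\pi}\int_{S_R}e^{\frac12\omega}\omega_{,k}N^k\,dA$ and $q=\lim_{R\to\infty}\frac1{4\pi}\int_{S_R}e^{-\frac12\omega}\phi_{,k}N^k\,dA$. Asymptotic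 flatness includes $\phi=O(1/r)$ and $e^{\omega}\to1$ at spatial infinity, so that the constant term of $e^{\omega}=C^2+2C\phi+\phi^2$ is $C^2=1$.
   Formalization: As stated m = |q| fails for negative total mass (φ = 1/√(1+r²), C = 1, g_ij = (1+φ)^{-2}δ_ij gives m = q = −1); what is proved is |m| = |q| always, and m = |q| whenever m ≥ 0. *)

(* Defs.v *)
From HB Require Import structures.
From mathcomp Require Import all_boot all_order all_algebra.
From mathcomp Require Import all_classical all_reals all_analysis.

Set Implicit Arguments.
Unset Strict Implicit.
Unset Printing Implicit Defensive.

Import Order.TTheory GRing.Theory Num.Theory.
Import numFieldNormedType.Exports.

Local Open Scope classical_set_scope.
Local Open Scope ring_scope.

(* Conventions.  Signature (+,+,+,-), units c = G = 1, Gaussian charge units.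
   Spatial points are row vectors in 'rV_3; events are row vectors in
   'rV_(3 + 1), whose last coordinate is x^4 = t.  Partial derivatives are
   directional derivatives along the coordinate axes. *)

Section Partial.
Context {R : realType}.

Definition partial {n : nat} (i : 'I_n) (f : 'rV[R]_n -> R) (x : 'rV[R]_n) : R :=
  'D_(delta_mx 0 i) f x.

(* f is of class C^k on D; meant for open D *)
Fixpoint class_C (k : nat) {n : nat} (D : set 'rV[R]_n) (f : 'rV[R]_n -> R)
    : Prop :=
  (forall x, D x -> {for x, continuous f}) /\
  match k with
  | 0 => True
  | k'.+1 => forall i : 'I_n,
      (forall x, D x -> derivable f x (delta_mx 0 i)) /\
      class_C k' D (partial i f)
  end.

(* the Euclidean coordinate radius r, as opposed to the sup norm `|x| *)
Definition radius {n : nat} (x : 'rV[R]_n) : R :=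
  Num.sqrt (\sum_(i < n) x 0 i ^+ 2).

(* f = O(1 / r^k) at spatial infinity *)
Definition falloff {n : nat} (k : nat) (f : 'rV[R]_n -> R) : Prop :=
  exists K r0 : R, 0 < r0 /\
    forall x, r0 < radius x -> `|f x| <= K / radius x ^+ k.

End Partial.

Section Tensors.
Context {R : realType}.
Local Notation idx := 'I_(3 + 1).
Local Notation event := 'rV[R]_(3 + 1).
Implicit Types (G F : event -> 'M[R]_(3 + 1)) (X : event -> 'rV[R]_(3 + 1)).

(* Gamma^l_{mn} *)
Definition christoffel G (l m n : idx) (y : event) : R :=
  2^-1 * \sum_k invmx (G y) l k *
    (partial m (fun z => G z k n) y + partial n (fun z => G z k m) y
     - partial k (fun z => G z m n) y).

Definition lower G X (y : event) : event := \row_n \sum_l G y n l * X y 0 l.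

(* nabla_m w_n for a covector field w *)
Definition nabla_covector G (w : event -> event) (m n : idx) (y : event) : R :=
  partial m (fun z => w z 0 n) y - \sum_l christoffel G l m n y * w y 0 l.

Definition ricci G (m n : idx) (y : event) : R :=
  \sum_l (partial l (christoffel G l m n) y - partial n (christoffel G l m l) y)
  + \sum_l \sum_k (christoffel G l l k y * christoffel G k m n y
                   - christoffel G l n k y * christoffel G k m l y).

Definition scalar_curvature G (y : event) : R :=
  \sum_m \sum_n invmx (G y) m n * ricci G m n y.

Definition einstein G (m n : idx) (y : event) : R :=
  ricci G m n y - 2^-1 * scalar_curvature G y * G y m n.

Definition raise2 G F (y : event) : 'M[R]_(3 + 1) :=
  invmx (G y) *m F y *m (invmx (G y))^T.

(* (4 pi)^-1 (F_{ma} F_n^a - G_{mn} F_{ab} F^{ab} / 4) *)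
Definition em_stress G F (m n : idx) (y : event) : R :=
  (4 * pi)^-1 *
  (\sum_a \sum_b F y m a * F y n b * invmx (G y) a b
   - 4^-1 * G y m n * \sum_a \sum_b F y a b * raise2 G F y a b).

(* nabla_n F^{mn} *)
Definition div_F G F (m : idx) (y : event) : R :=
  \sum_n (partial n (fun z => raise2 G F z m n) y
    + \sum_l (christoffel G m n l y * raise2 G F y l n
              + christoffel G n n l y * raise2 G F y m l)).

End Tensors.

(* The components are total functions, but are meaningful on sf_dom only. The
   chart domain need not be all of R^3, so that punctures are allowed. *)
Record static_field (R : realType) := StaticField {
  sf_dom : set 'rV[R]_3;
  sf_g : 'rV[R]_3 -> 'M[R]_3;               (* g_ij *)
  sf_omega : 'rV[R]_3 -> R;
  sf_phi : 'rV[R]_3 -> R;                   (* electric potential *)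
  sf_T : 'rV[R]_(3 + 1) -> 'M[R]_(3 + 1);   (* matter tensor T_{mu nu} *)
  sf_sigma : 'rV[R]_(3 + 1) -> R            (* proper charge density *)
}.

Section StaticField.
Context {R : realType}.
Variable S : static_field R.
Local Notation idx := 'I_(3 + 1).
Local Notation event := 'rV[R]_(3 + 1).

Definition time_idx : idx := rshift 3 ord0.

(* spatial coordinates of an event; the point x of the hypersurface t = 0 *)
Definition space_of (y : event) : 'rV[R]_3 := lsubmx y.
Definition at_rest (x : 'rV[R]_3) : event := row_mx x 0.

(* ds^2 = g_ij dx^i dx^j - e^omega dt^2 *)
Definition metric (y : event) : 'M[R]_(3 + 1) :=
  block_mx (sf_g S (space_of y)) 0 0 (- expR (sf_omega S (space_of y)))%:M.

(* F_{i4} = phi_{,i} = - F_{4i} and F_{ij} = 0 *)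
Definition faraday (y : event) : 'M[R]_(3 + 1) :=
  let dphi : 'rV[R]_3 := \row_i partial i (sf_phi S) (space_of y) in
  block_mx 0 dphi^T (- dphi) 0.

(* xi^mu = delta^mu_4 *)
Definition killing (y : event) : event := delta_mx 0 time_idx.
Definition killing_low : event -> event := lower metric killing.

(* (- xi_alpha xi^alpha)^(1/2) *)
Definition killing_norm (y : event) : R :=
  Num.sqrt (- \sum_a killing_low y 0 a * killing y 0 a).

(* future-pointing unit normal to t = const *)
Definition unit_t (y : event) : event := (killing_norm y)^-1 *: killing y.

Definition static_metric : Prop :=
  [/\ open (sf_dom S),
      forall i j, class_C 2 (sf_dom S) (fun x => sf_g S x i j),
      class_C 2 (sf_dom S) (sf_omega S),
      class_C 2 (sf_dom S) (sf_phi S) &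
      forall x, sf_dom S x ->
        (sf_g S x)^T = sf_g S x /\
        forall v : 'rV[R]_3, v != 0 -> 0 < (v *m sf_g S x *m v^T) 0 0].

(* The current of the static charge distribution is sigma t^mu; the sign in
   the source equation makes a positive sigma contribute positively to the
   total charge below. *)
Definition einstein_maxwell : Prop :=
  forall y : event, sf_dom S (space_of y) ->
  [/\ forall m n, einstein metric m n y =
        8 * pi * (sf_T S y m n + em_stress metric faraday m n y),
      forall l m n,
        partial l (fun z => faraday z m n) y
        + partial m (fun z => faraday z n l) y
        + partial n (fun z => faraday z l m) y = 0 &
      forall m, div_F metric faraday m y = 4 * pi * sf_sigma S y * unit_t y 0 m].

Definition static_electrogravitational : Prop :=
  static_metric /\ einstein_maxwell.

Definition minkowski : 'M[R]_(3 + 1) := block_mx 1%:M 0 0 (- 1)%:M.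

Definition asymptotically_flat : Prop :=
  [/\ exists r0 : R, [set x | r0 < radius x] `<=` sf_dom S,
      forall m n : idx,
        falloff 1 (fun x => metric (at_rest x) m n - minkowski m n),
      forall (k : 'I_3) (m n : idx),
        falloff 2 (partial k (fun x => metric (at_rest x) m n)),
      falloff 1 (sf_phi S) &
      forall k : 'I_3, falloff 2 (partial k (sf_phi S))].

Definition majumdar_type : Prop :=
  exists C : R, forall x, sf_dom S x ->
    expR (sf_omega S x) = (C + sf_phi S x) ^+ 2.

(* N^i = g^{ij} x_j / (g^{kl} x_k x_l)^(1/2): the g-unit vector along the
   gradient of r, hence g-orthogonal to S_r and outward; as a four-vector
   N^4 = 0 *)
Definition normal (x : 'rV[R]_3) : event :=
  let gi := invmx (sf_g S x) in
  row_mx ((Num.sqrt ((x *m gi *m x^T) 0 0))^-1 *: (x *m gi^T)) 0.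

Definition sphere_pt (r th ps : R) : 'rV[R]_3 :=
  \row_i [:: r * sin th * cos ps; r * sin th * sin ps; r * cos th]`_i.

(* dA / (d theta d psi) = (det of the pulled-back metric)^(1/2), the rows of J
   being the two coordinate tangent vectors *)
Definition area_density (r th ps : R) : R :=
  let J : 'M[R]_(1 + 1, 3) :=
    col_mx (derive1 (fun s => sphere_pt r s ps) th)
           (derive1 (fun s => sphere_pt r th s) ps) in
  Num.sqrt (\det (J *m sf_g S (sphere_pt r th ps) *m J^T)).

Definition sphere_integral (r : R) (f : 'rV[R]_3 -> R) : R :=
  \int[lebesgue_measure]_(th in `[0, pi])
    \int[lebesgue_measure]_(ps in `[0, 2 * pi])
      (f (sphere_pt r th ps) * area_density r th ps).

(* xi^mu (- xi_a xi^a)^(-1/2) nabla_mu xi_nu N^nu *)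
Definition mass_density (x : 'rV[R]_3) : R :=
  let y := at_rest x in
  \sum_m \sum_n killing y 0 m / killing_norm y *
    nabla_covector metric killing_low m n y * normal x 0 n.

(* F_{mu nu} N^mu t^nu *)
Definition charge_density (x : 'rV[R]_3) : R :=
  let y := at_rest x in
  \sum_m \sum_n faraday y m n * normal x 0 m * unit_t y 0 n.

Definition is_total_mass (m : R) : Prop :=
  (4 * pi)^-1 * sphere_integral r mass_density @[r --> +oo] --> m.

Definition is_total_charge (q : R) : Prop :=
  (4 * pi)^-1 * sphere_integral r charge_density @[r --> +oo] --> q.

End StaticField.

(* Main.v *)
(** In a Majumdar-type field [e^(omega/2) = |C + phi|], and the flat limit forces
    [C^2 = 1], so far out [|C + phi| = 1 + C phi].  With [h = phi_,i N^i], the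
    mass integrand is then [C h] and the charge integrand [h / (1 + C phi)].
    They differ, after multiplying the latter by [C], by
    [h phi / (1 + C phi) = O(1/r^3)], while the area is [O(r^2)]; hence
    [m = C q]. *)

Require Import Defs.
From mathcomp Require Import all_boot all_order all_algebra.
From mathcomp Require Import all_classical all_reals all_analysis.
From mathcomp Require Import ring lra.

Set Implicit Arguments.
Unset Strict Implicit.
Unset Printing Implicit Defensive.

Import Order.TTheory GRing.Theory Num.Theory.
Import numFieldNormedType.Exports.

Local Open Scope classical_set_scope.
Local Open Scope ring_scope.

(** * Entrywise continuity and iterated integrals *)

Section EntrywiseContinuity.
Context {R : realType} {T : topologicalType} (t : T).

(** Working entry by entry reduces products, determinants and inverses of matrices to sums and
    products of real functions; [mx_continuous_cvg] goes back to the matrix topology. *)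
Definition mx_continuous_at m n (M : T -> 'M[R]_(m, n)) : Prop :=
  forall i j, {for t, continuous (fun s => M s i j)}.

Lemma continuous_at_sum (I : Type) (r : seq I) (P : pred I) (f : I -> T -> R) :
  (forall i, {for t, continuous (f i)}) ->
  {for t, continuous (fun s => \sum_(i <- r | P i) f i s)}.
Proof. by move=> cf; apply: cvg_big => [|i _]; [exact: add_continuous|exact: cf]. Qed.

Lemma continuous_at_prod (I : Type) (r : seq I) (P : pred I) (f : I -> T -> R) :
  (forall i, {for t, continuous (f i)}) ->
  {for t, continuous (fun s => \prod_(i <- r | P i) f i s)}.
Proof. by move=> cf; apply: cvg_big => [|i _]; [exact: mul_continuous|exact: cf]. Qed.

Lemma mx_continuous_mul m n p (A : T -> 'M[R]_(m, n)) (B : T -> 'M[R]_(n, p)) :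
  mx_continuous_at A -> mx_continuous_at B ->
  mx_continuous_at (fun s => A s *m B s).
Proof.
move=> cA cB i j.
under [X in {for _, continuous X}]funext do rewrite mxE.
by apply: continuous_at_sum => k; apply: continuousM; [exact: cA|exact: cB].
Qed.

Lemma mx_continuous_tr m n (A : T -> 'M[R]_(m, n)) :
  mx_continuous_at A -> mx_continuous_at (fun s => (A s)^T).
Proof.
move=> cA i j; under [X in {for _, continuous X}]funext do rewrite mxE.
exact: cA.
Qed.

Lemma mx_continuous_det n (A : T -> 'M[R]_n) :
  mx_continuous_at A -> {for t, continuous (fun s => \det (A s))}.
Proof.
move=> cA; rewrite /determinant.
apply: continuous_at_sum => s; apply: cvgM; first exact: cvg_cst.
by apply: continuous_at_prod => i; exact: cA.
Qed.

Lemma mx_continuous_adj n (A : T -> 'M[R]_n) :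
  mx_continuous_at A -> mx_continuous_at (fun s => \adj (A s)).
Proof.
move=> cA i j; under [X in {for _, continuous X}]funext do rewrite mxE.
apply: cvgM; first exact: cvg_cst.
apply: mx_continuous_det => k l.
under [X in {for _, continuous X}]funext do rewrite !mxE.
exact: cA.
Qed.

(** Invertibility at every [s] lets [invmx] unfold to the adjugate over the determinant for the
    whole family, avoiding its default value on singular matrices. *)
Lemma mx_continuous_inv n (A : T -> 'M[R]_n) :
  (forall s, A s \in unitmx) ->
  mx_continuous_at A -> mx_continuous_at (fun s => invmx (A s)).
Proof.
move=> uA cA i j.
under [X in {for _, continuous X}]funext do rewrite /invmx uA mxE.
apply: cvgM; last exact: mx_continuous_adj.
apply: cvgV; last exact: mx_continuous_det.
by have := uA t; rewrite unitmxE unitfE.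
Qed.

Lemma mx_continuous_col m1 m2 n (A : T -> 'M[R]_(m1, n)) (B : T -> 'M[R]_(m2, n)) :
  mx_continuous_at A -> mx_continuous_at B ->
  mx_continuous_at (fun s => col_mx (A s) (B s)).
Proof.
move=> cA cB i j; case: (split_ordP i) => k ->.
  by under [X in {for _, continuous X}]funext do rewrite col_mxEu; exact: cA.
by under [X in {for _, continuous X}]funext do rewrite col_mxEd; exact: cB.
Qed.

(** A neighbourhood of a matrix contains a box of neighbourhoods of its entries, and finitely many
    entrywise conditions can be intersected. *)
Lemma mx_continuous_cvg m n (A : T -> 'M[R]_(m, n)) :
  mx_continuous_at A -> {for t, continuous A}.
Proof.
move=> cA B [P nP sPB]; rewrite nbhs_filterE in nP *.
apply: (@filterS _ _ _ [set s | forall ij : 'I_m * 'I_n, P ij.1 ij.2 (A s ij.1 ij.2)]).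
  by move=> s sP; apply: sPB => i j; exact: (sP (i, j)).
by apply: filter_forall => -[i j]; exact: (cA i j _ (nP i j)).
Qed.

End EntrywiseContinuity.

Section IteratedIntegral.
Context {R : realType}.
Local Notation mu := (@lebesgue_measure R).
Implicit Types f : R -> R.

Lemma continuous_integrable_segment f a b :
  continuous f -> mu.-integrable `[a, b] (EFin \o f).
Proof.
move=> cf; apply: continuous_compact_integrable; first exact: segment_compact.
exact: continuous_subspaceT.
Qed.

Lemma Rintegral_segment_le f a b e : a <= b -> continuous f ->
  (forall x, `|f x| <= e) -> `|\int[mu]_(x in `[a, b]) f x| <= e * (b - a).
Proof.
move=> ab cf fe; have fi := continuous_integrable_segment a b cf.
apply: (le_trans (le_normr_Rintegral _ fi)) => //.
apply: (@le_trans _ _ (\int[mu]_(x in `[a, b]) e)).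
  apply: le_Rintegral => //.
    by apply: continuous_integrable_segment => x; apply: cvg_norm; exact: cf.
  by apply: continuous_integrable_segment => x; exact: cvg_cst.
rewrite Rintegral_cst//= lebesgue_measure_itv/= lte_fin -EFinD.
(* The length formula splits on [a < b]; in the degenerate case [a = b] both values are zero. *)
by case: ltgtP ab => //= ->; rewrite subrr.
Qed.

(** Continuity in [y] makes the inner integrals exist; continuity in [x], together with a uniform
    bound, passes to them by dominated convergence. *)
Definition separately_continuous (f : R -> R -> R) : Prop :=
  (forall x, continuous (f x)) /\ (forall y, continuous (f ^~ y)).

Lemma continuous_Rintegral_param (f : R -> R -> R) c d M :
  separately_continuous f -> (forall x y, `|f x y| <= M) ->
  continuous (fun x => \int[mu]_(y in `[c, d]) f x y).
Proof.
move=> [cf1 cf2] fM x.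
(* Dominated convergence is applied on a unit window around [x], with the constant [M] as dominating
   function. *)
apply: (@continuity_under_integral _ _ _ mu f `[c, d] _ (x - 1) (x + 1) _ _ (cst M)) => //.
- by move=> u _; exact: continuous_integrable_segment.
- by apply: aeW => y _ u _; exact: cf2.
- by apply: continuous_integrable_segment => u; exact: cvg_cst.
- by move=> u _; apply: aeW => y _ /=; exact: fM.
- by rewrite inE/= in_itv/=; apply/andP; split; lra.
Qed.

(** By linearity the difference is one iterated integral of [f1 - k f2], estimated by [e] in each
    variable in turn; [M] serves to make the inner integrals continuous in [x]. *)
Lemma iterated_Rintegral_close (f1 f2 : R -> R -> R) (k a b c d M e : R) :
  a <= b -> c <= d ->
  separately_continuous f1 -> separately_continuous f2 ->
  (forall x y, `|f1 x y| <= M) -> (forall x y, `|f2 x y| <= M) ->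
  (forall x y, `|f1 x y - k * f2 x y| <= e) ->
  `|\int[mu]_(x in `[a, b]) \int[mu]_(y in `[c, d]) f1 x y
    - k * \int[mu]_(x in `[a, b]) \int[mu]_(y in `[c, d]) f2 x y|
  <= e * (d - c) * (b - a).
Proof.
move=> ab cd cf1 cf2 f1M f2M f12.
have c1 := @continuous_Rintegral_param f1 c d M cf1 f1M.
have c2 := @continuous_Rintegral_param f2 c d M cf2 f2M.
have ckf2 x : continuous (fun y => k * f2 x y).
  by move=> y; apply: cvgM; [exact: cvg_cst|exact: cf2.1].
rewrite -RintegralZl//; last exact: continuous_integrable_segment.
rewrite -RintegralB//; first last.
- apply: continuous_integrable_segment => x.
  by apply: cvgM; [exact: cvg_cst|exact: c2].
- exact: continuous_integrable_segment.
apply: Rintegral_segment_le => // [x|x].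
  by apply: cvgB; [exact: c1|apply: cvgM; [exact: cvg_cst|exact: c2]].
rewrite -RintegralZl//; last exact/continuous_integrable_segment/cf2.1.
rewrite -RintegralB//; first last.
- exact: continuous_integrable_segment.
- exact/continuous_integrable_segment/cf1.1.
apply: Rintegral_segment_le => // y.
by apply: cvgB; [exact: cf1.1|exact: ckf2].
Qed.

End IteratedIntegral.

(** * The mass and charge densities *)

Section StaticDensities.
Context {R : realType} (S : static_field R).
Local Notation D := (sf_dom S).
Local Notation G := (metric S).

Lemma space_of_at_rest (x : 'rV[R]_3) : space_of (at_rest x) = x.
Proof. exact: row_mxKl. Qed.

(** [space_of] commutes with a displacement along a spatial axis, so the two difference quotients
    are the same function of [h]. *)
Lemma partial_space_of (f : 'rV[R]_3 -> R) i y :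
  partial (lshift 1 i) (fun z => f (space_of z)) y = partial i f (space_of y).
Proof.
rewrite /partial /derive; set u := (X in fmap X); set v := (X in _ = lim (fmap X _)).
suff -> : u = v by [].
apply/funext => h; rewrite /u /v /=; congr (_ *: (f _ - _)); apply/rowP => j; rewrite !mxE !eqxx /=.
by rewrite (inj_eq (@lshift_inj _ _)).
Qed.

Lemma partial_time_space_of (f : 'rV[R]_3 -> R) y :
  partial time_idx (fun z => f (space_of z)) y = 0.
Proof.
rewrite /partial /derive.
suff -> : (fun h : R => h^-1 *: (((fun z => f (space_of z)) \o shift y)
    (h *: delta_mx 0 time_idx) - f (space_of y))) = cst 0.
  by apply/cvg_lim => //; exact: cvg_cst.
apply/funext => h /=; suff -> : space_of (h *: delta_mx 0 time_idx + y) = space_of y.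
  by rewrite subrr scaler0.
apply/rowP => j; rewrite !mxE eqxx /=.
by rewrite eq_lrshift mulr0 add0r.
Qed.

Lemma partial_cst n (i : 'I_n) (a : R) y : partial i (fun=> a) y = 0.
Proof. exact: derive_cst. Qed.

Lemma metric_time_space y i : G y time_idx (lshift 1 i) = 0.
Proof. by rewrite /metric block_mxEdl mxE. Qed.

Lemma metric_space_time y i : G y (lshift 1 i) time_idx = 0.
Proof. by rewrite /metric block_mxEur mxE. Qed.

Lemma metric_time_time y : G y time_idx time_idx = - expR (sf_omega S (space_of y)).
Proof. by rewrite /metric block_mxEdr mxE eqxx mulr1n. Qed.

Lemma killing_space y i : killing y 0 (lshift 1 i) = 0 :> R.
Proof. by rewrite /killing mxE eqxx eq_lrshift. Qed.

Lemma killing_time y : killing y 0 time_idx = 1 :> R.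
Proof. by rewrite /killing mxE !eqxx. Qed.

Lemma killing_lowE y n : killing_low S y 0 n = G y n time_idx.
Proof.
rewrite /killing_low /lower mxE big_split_ord big_ord1 /= big1 => [|i _].
  by rewrite killing_time mulr1 add0r.
by rewrite killing_space mulr0.
Qed.

Lemma killing_normE y : killing_norm S y = Num.sqrt (expR (sf_omega S (space_of y))).
Proof.
rewrite /killing_norm big_split_ord big_ord1 /= big1 => [|i _].
  by rewrite killing_time killing_lowE metric_time_time mulr1 add0r opprK.
by rewrite killing_space mulr0.
Qed.

Lemma invmx_metric y : sf_g S (space_of y) \in unitmx ->
  invmx (G y) = block_mx (invmx (sf_g S (space_of y))) 0 0
    (- expR (sf_omega S (space_of y)))^-1%:M.
Proof.
move=> gu; rewrite /metric invmx_block_diag ?invmx_scalar//.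
rewrite block_diag_mx_unit gu unitmxE det_scalar1 unitfE oppr_eq0.
by rewrite gt_eqF ?expR_gt0.
Qed.

(** The inverse metric is block diagonal, so only the time index survives in the sum. The value is
    omega_{,i} / 2, kept as a derivative of - e^omega because the Majumdar relation rewrites exactly
    that component. *)
Lemma christoffel_time y i : sf_g S (space_of y) \in unitmx ->
  christoffel G time_idx time_idx (lshift 1 i) y =
  - (2^-1 * (expR (sf_omega S (space_of y)))^-1
     * partial i (fun x => - expR (sf_omega S x)) (space_of y)).
Proof.
move=> gu; rewrite /christoffel big_split_ord big_ord1 /= big1 => [|k _].
  rewrite invmx_metric// block_mxEdr mxE eqxx mulr1n add0r.
  have e1 : (fun z => G z (rshift 3 ord0) (lshift 1 i)) = fun=> 0.
    by apply/funext => z; rewrite metric_time_space.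
  have e2 : (fun z => G z (rshift 3 ord0) time_idx) =
      fun z => (fun x => - expR (sf_omega S x)) (space_of z).
    by apply/funext => z; rewrite metric_time_time.
  rewrite e1 e2 !partial_cst (partial_space_of (fun x => - expR (sf_omega S x))) add0r subr0 invrN.
  by rewrite mulNr mulrN mulrA.
by rewrite invmx_metric// block_mxEdl mxE mul0r.
Qed.

(** The normal derivative of the potential, the factor shared by the mass and charge integrands. *)
Definition normal_flux (x : 'rV[R]_3) : R :=
  \sum_(i < 3) partial i (sf_phi S) x * normal S x 0 (lshift 1 i).

Lemma normal_time x : normal S x 0 time_idx = 0.
Proof. by rewrite /normal row_mxEr mxE. Qed.

(** Since N^4 = 0 and t^mu has only a time component, just F_{i4} N^i t^4 remains, with t^4 =
    e^(-omega/2). *)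
Lemma charge_densityE x : charge_density S x =
  normal_flux x / Num.sqrt (expR (sf_omega S x)).
Proof.
rewrite /charge_density big_split_ord big_ord1 /= [X in _ + X]big1 => [|n _].
  rewrite addr0 /normal_flux mulr_suml; apply: eq_bigr => i _.
  rewrite big_split_ord big_ord1 /= big1 => [|j _].
    rewrite add0r /faraday block_mxEur !mxE space_of_at_rest.
    rewrite killing_normE space_of_at_rest eqxx /= -/time_idx.
    by rewrite mulr1.
  have -> : unit_t S (at_rest x) 0 (lshift 1 j) = 0.
    by rewrite /unit_t mxE killing_space mulr0.
  by rewrite mulr0.
by rewrite normal_time mulr0 mul0r.
Qed.

(** Here nabla_4 xi_i = - Gamma^4_{4i} xi_4, because xi_i vanishes identically; this equals e^omega
    omega_{,i} / 2 and is divided by the norm e^(omega/2). *)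
Lemma mass_densityE x : sf_g S x \in unitmx ->
  mass_density S x = - (2^-1 / Num.sqrt (expR (sf_omega S x))
    * \sum_(i < 3) partial i (fun z => - expR (sf_omega S z)) x
                   * normal S x 0 (lshift 1 i)).
Proof.
move=> gu; rewrite /mass_density big_split_ord big_ord1 /= big1 => [|m _]; last first.
  by rewrite big1 // => n _; rewrite killing_space !mul0r.
rewrite add0r big_split_ord big_ord1 /= normal_time mulr0 addr0.
rewrite -mulrN -sumrN mulr_sumr; apply: eq_bigr => i _.
rewrite -/time_idx killing_time killing_normE space_of_at_rest mul1r.
rewrite /nabla_covector.
have -> : (fun z => killing_low S z 0 (lshift 1 i)) = fun=> 0.
  by apply/funext => z; rewrite killing_lowE metric_space_time.
rewrite partial_cst sub0r big_split_ord big_ord1 /= big1 => [|k _]; last first.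
  by rewrite killing_lowE metric_space_time mulr0.
rewrite add0r -/time_idx christoffel_time space_of_at_rest//.
rewrite killing_lowE metric_time_time space_of_at_rest mulrNN.
rewrite -!mulrA; have : expR (sf_omega S x) != 0 by rewrite gt_eqF ?expR_gt0.
set E := expR _; set q := (Num.sqrt _)^-1; by move=> E0; field.
Qed.

(** The relation gives e^(omega/2) = |C + phi| and, once differentiated, (e^omega)_{,i} = 2 (C +
    phi) phi_{,i}. *)
Lemma majumdar_densities C x : static_metric S -> sf_g S x \in unitmx ->
  (forall z, D z -> expR (sf_omega S z) = (C + sf_phi S z) ^+ 2) -> D x ->
  mass_density S x = (C + sf_phi S x) / `|C + sf_phi S x| * normal_flux x /\
  charge_density S x = normal_flux x / `|C + sf_phi S x|.
Proof.
move=> [oD _ _ [_ cphi] _] gu maj Dx.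
rewrite charge_densityE mass_densityE// maj// sqrtr_sqr; split=> //.
rewrite /normal_flux !mulr_sumr -sumrN; apply: eq_bigr => i _.
have -> : partial i (fun z => - expR (sf_omega S z)) x =
    partial i (fun z => - (C + sf_phi S z) ^+ 2) x.
  (* The relation holds on the chart domain only; openness makes the two functions agree near [x],
     which is enough for derivatives. *)
  apply: near_eq_derive; have /= := open_nbhs_nbhs (conj oD Dx).
  by apply: filterS => z Dz /=; rewrite maj.
have [dphi _] := cphi i.
have dP : is_derive x (delta_mx 0 i) (fun z => C + sf_phi S z)
    (partial i (sf_phi S) x).
  have := is_deriveD (is_derive_cst C x (delta_mx 0 i)) (derivableP (dphi x Dx)).
  by rewrite add0r.
have -> : partial i (fun z => - (C + sf_phi S z) ^+ 2) x =
    - (2 * (C + sf_phi S x) * partial i (sf_phi S) x).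
  have H := is_deriveN (is_deriveX 2 dP).
  rewrite [LHS](@derive_val _ _ _ _ _ _ _ H).
  by rewrite /GRing.scale/= expr1 mulr_natl.
by set q := `| _ |^-1; field.
Qed.

End StaticDensities.

(** * Quadratic forms *)

Local Notation radius := Defs.radius.

Lemma det_mx22 (R : comNzRingType) (M : 'M[R]_2) :
  \det M = M 0 0 * M 1 1 - M 0 1 * M 1 0.
Proof.
rewrite (expand_det_row _ 0) !big_ord_recl big_ord0 /cofactor !det_mx11 !mxE /=.
rewrite (_ : lift _ _ = 1); last exact/val_inj.
rewrite (_ : lift 1 0 = 0); last exact/val_inj.
by rewrite !expr0 expr1 addr0 mul1r mulN1r mulrN.
Qed.

Section QuadraticForms.
Context {R : realType} {n : nat}.
Implicit Types (g : 'M[R]_n) (v : 'rV[R]_n).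

Lemma dot_sum v : (v *m v^T) 0 0 = \sum_i v 0 i ^+ 2.
Proof. by rewrite mxE; apply: eq_bigr => i _; rewrite mxE expr2. Qed.

Lemma dot_radius v : (v *m v^T) 0 0 = radius v ^+ 2.
Proof. by rewrite dot_sum sqr_sqrtr// sumr_ge0// => i _; exact: sqr_ge0. Qed.

Lemma coord_le_radius v i : `|v 0 i| <= radius v.
Proof.
rewrite -(@ler_pXn2r _ 2)// ?nnegrE ?sqrtr_ge0// real_normK ?num_real//.
rewrite -dot_radius dot_sum (bigD1 i)//= lerDl sumr_ge0// => j _.
exact: sqr_ge0.
Qed.

(** Each term of the perturbation is bounded through |v_i v_j| <= (v_i^2 + v_j^2) / 2; summing over
    both indices produces the factor [n]. *)
Lemma quad_form_close g (e : R) v : (forall i j, `|g i j - (1%:M : 'M[R]_n) i j| <= e) ->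
  `|(v *m g *m v^T) 0 0 - radius v ^+ 2| <= e * n%:R * radius v ^+ 2.
Proof.
move=> ge; rewrite -dot_radius.
have -> : (v *m g *m v^T) 0 0 - (v *m v^T) 0 0 =
    \sum_i \sum_j v 0 i * (g - 1%:M) i j * v 0 j.
  have -> : (v *m g *m v^T) 0 0 - (v *m v^T) 0 0 =
      (v *m (g - 1%:M) *m v^T) 0 0 by rewrite mulmxBr mulmx1 mulmxBl !mxE.
  rewrite mxE exchange_big/=; apply: eq_bigr => j _.
  by rewrite !mxE mulr_suml; apply: eq_bigr => i _; rewrite !mxE.
apply: (@le_trans _ _ (\sum_i \sum_j e * ((v 0 i ^+ 2 + v 0 j ^+ 2) / 2))).
  apply: (le_trans (ler_norm_sum _ _ _)); apply: ler_sum => i _.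
  apply: (le_trans (ler_norm_sum _ _ _)); apply: ler_sum => j _.
  have e0 : 0 <= e by apply: le_trans (ge i j).
  rewrite !normrM -mulrA mulrCA ler_pM//.
    by have := ge i j; rewrite !mxE.
  rewrite -(real_normK (num_real (v 0 i))) -(real_normK (num_real (v 0 j))).
  have := sqr_ge0 (`|v 0 i| - `|v 0 j|); rewrite ler_pdivlMr// sqrrB => H.
  by lra.
have -> : \sum_i \sum_j e * ((v 0 i ^+ 2 + v 0 j ^+ 2) / 2) =
    e * n%:R * \sum_i v 0 i ^+ 2.
  under eq_bigr do rewrite -mulr_sumr -mulr_suml big_split/=.
  rewrite -mulr_sumr -mulr_suml big_split/= sumr_const.
  under eq_bigr do rewrite sumr_const.
  rewrite sumrMnl card_ord; set q := \sum_i _.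
  by rewrite -(mulr_natl q); field.
by rewrite dot_sum.
Qed.

Definition posdef g : Prop :=
  g^T = g /\ forall v, v != 0 -> 0 < (v *m g *m v^T) 0 0.

Lemma posdef_ge0 g v : posdef g -> 0 <= (v *m g *m v^T) 0 0.
Proof.
move=> [_ pg]; have [->|/pg/ltW//] := eqVneq v 0.
by rewrite !mul0mx mxE.
Qed.

Lemma posdef_unitmx g : posdef g -> g \in unitmx.
Proof.
move=> [_ pg]; rewrite unitmxE unitfE; apply/negP => /det0P[v v0 vg].
by have := pg v v0; rewrite vg mul0mx mxE ltxx.
Qed.

(** The inverse form at [v] is the form of [g] at v g^-1, a nonzero vector. *)
Lemma posdef_inv g : posdef g -> posdef (invmx g).
Proof.
move=> pg; have gu := posdef_unitmx pg; case: (pg) => sg pg0.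
have sgi : (invmx g)^T = invmx g by rewrite trmx_inv sg.
split=> // v v0.
have -> : v *m invmx g *m v^T = (v *m invmx g) *m g *m (v *m invmx g)^T.
  by rewrite trmx_mul sgi mulmxKV// mulmxA.
apply: pg0; apply: contra_neq v0 => v0.
by rewrite -(mulmxKV gu v) v0 mul0mx.
Qed.

(** The vector [w] is the spatial part of [normal]: raising the index of [v] gives a vector whose
    squared [g]-length is v g^-1 v^T. *)
Lemma posdef_normalize g v : posdef g -> v != 0 ->
  let w := (Num.sqrt ((v *m invmx g *m v^T) 0 0))^-1 *: (v *m (invmx g)^T) in
  (w *m g *m w^T) 0 0 = 1.
Proof.
move=> pg v0 w; have pgi := posdef_inv pg.
have q0 := pgi.2 v v0; rewrite {}/w pgi.1.
set q := (v *m invmx g *m v^T) 0 0 in q0 *.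
rewrite linearZ/= -!scalemxAl -scalemxAr trmx_mul pgi.1 mulmxKV ?posdef_unitmx//.
rewrite mulmxA 2!mxE -/q mulrA -invfM -expr2 sqr_sqrtr ?ltW//.
by rewrite mulVf// gt_eqF.
Qed.

(** The Gram determinant is the product of the squared lengths minus the square of g(a, b). This
    bounds an area element by the lengths of its two tangent vectors. *)
Lemma posdef_gram2 g (a b : 'rV[R]_n) : posdef g ->
  \det (col_mx a b *m g *m (col_mx a b)^T) <=
  (a *m g *m a^T) 0 0 * (b *m g *m b^T) 0 0.
Proof.
move=> pg; rewrite mul_col_mx tr_col_mx mul_col_row.
set M := block_mx _ _ _ _.
have -> : \det M = (a *m g *m a^T) 0 0 * (b *m g *m b^T) 0 0
    - (a *m g *m b^T) 0 0 * (b *m g *m a^T) 0 0.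
  (* Each goal identifies an index of the 2 x 2 matrix with the corresponding index of its 1 + 1
     block form. *)
  rewrite [LHS]det_mx22; congr (_ * _ - _ * _).
  - by rewrite -[RHS](@block_mxEul _ 1 1 1 1 _ (a *m g *m b^T) (b *m g *m a^T) (b *m g *m b^T));
      congr (block_mx _ _ _ _ _ _); exact/val_inj.
  - by rewrite -[RHS](@block_mxEdr _ 1 1 1 1 (a *m g *m a^T) (a *m g *m b^T) (b *m g *m a^T));
      congr (block_mx _ _ _ _ _ _); exact/val_inj.
  - by rewrite -[RHS](@block_mxEur _ 1 1 1 1 (a *m g *m a^T) _ (b *m g *m a^T) (b *m g *m b^T));
      congr (block_mx _ _ _ _ _ _); exact/val_inj.
  - by rewrite -[RHS](@block_mxEdl _ 1 1 1 1 (a *m g *m a^T) (a *m g *m b^T) _ (b *m g *m b^T));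
      congr (block_mx _ _ _ _ _ _); exact/val_inj.
have -> : b *m g *m a^T = (a *m g *m b^T)^T.
  by rewrite !trmx_mul trmxK pg.1 mulmxA.
by set x := a *m g *m b^T; rewrite [x^T _ _]mxE -expr2 gerBl sqr_ge0.
Qed.

End QuadraticForms.

(** * Common constants for finitely many falloff conditions *)

Section Falloff.
Context {R : realType} {n : nat}.

Lemma falloff_uniform (I : finType) k (f : I -> 'rV[R]_n -> R) :
  (forall i, falloff k (f i)) ->
  exists K r0 : R, [/\ 0 <= K, 0 < r0 & forall i x, r0 < radius x ->
    `|f i x| <= K / radius x ^+ k].
Proof.
move=> /choice[K /choice[r0 H]].
(* Sums of absolute values dominate every single constant; the added 1 keeps the threshold positive
   even when [I] is empty. *)
exists (\sum_i `|K i|), (1 + \sum_i `|r0 i|); split.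
- exact: sumr_ge0.
- by rewrite ltr_pwDl// sumr_ge0.
move=> i x rx; have [_ Hi] := H i.
have r0x : r0 i < radius x.
  apply: le_lt_trans rx; rewrite (le_trans (ler_norm _))//.
  by rewrite (bigD1 i)//= addrCA lerDl addr_ge0// sumr_ge0.
apply: (le_trans (Hi x r0x)); rewrite ler_wpM2r ?invr_ge0 ?exprn_ge0 ?sqrtr_ge0//.
rewrite (le_trans (ler_norm _))//.
by rewrite (bigD1 i)//= lerDl sumr_ge0.
Qed.

End Falloff.

(** * Coordinate spheres *)

Section Sphere.
Context {R : realType}.
Implicit Types r th ps : R.

Definition row3 (a b c : R) : 'rV[R]_3 := \row_i [:: a; b; c]`_i.

Lemma row3_continuous (T : topologicalType) (t : T) (a b c : T -> R) :
  {for t, continuous a} -> {for t, continuous b} -> {for t, continuous c} ->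
  mx_continuous_at t (fun s => row3 (a s) (b s) (c s)).
Proof.
move=> ca cb cc i j.
by case: j => -[|[|[|//]]] j3; under [X in {for _, continuous X}]funext do rewrite mxE.
Qed.

Lemma row3_radius (a b c : R) : radius (row3 a b c) ^+ 2 = a ^+ 2 + b ^+ 2 + c ^+ 2.
Proof.
by rewrite -dot_radius dot_sum !big_ord_recl big_ord0 !mxE /= addr0 addrA.
Qed.

Lemma is_derive_row3 (a b c : R -> R) (t a' b' c' : R) :
  is_derive t 1 a a' -> is_derive t 1 b b' -> is_derive t 1 c c' ->
  derive1 (fun s => row3 (a s) (b s) (c s)) t = row3 a' b' c'.
Proof.
move=> [da ea] [db eb] [dc ec].
have ent i j : (fun s => row3 (a s) (b s) (c s) i j) = [:: a; b; c]`_j.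
  by apply/funext => s; rewrite mxE; case: j => -[|[|[|//]]] j3.
rewrite derive1E derive_mx.
  apply/rowP => j; rewrite !mxE ent.
  by case: j => -[|[|[|//]]] j3 /=.
apply/derivable_mxP => i j; rewrite ent.
by case: j => -[|[|[|//]]] j3 /=.
Qed.

Lemma sphere_pt_row3 r th ps : sphere_pt r th ps =
  row3 (r * sin th * cos ps) (r * sin th * sin ps) (r * cos th).
Proof. by []. Qed.

Lemma sphere_pt_dth r th ps : derive1 (fun s => sphere_pt r s ps) th =
  row3 (r * cos th * cos ps) (r * cos th * sin ps) (- (r * sin th)).
Proof.
apply: is_derive_row3.
- by apply: (@is_derive_eq _ _ _ (fun s => r * sin s * cos ps)); rewrite /GRing.scale/=; ring.
- by apply: (@is_derive_eq _ _ _ (fun s => r * sin s * sin ps)); rewrite /GRing.scale/=; ring.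
- by apply: (@is_derive_eq _ _ _ (fun s => r * cos s)); rewrite /GRing.scale/=; ring.
Qed.

Lemma sphere_pt_dps r th ps : derive1 (fun s => sphere_pt r th s) ps =
  row3 (- (r * sin th * sin ps)) (r * sin th * cos ps) 0.
Proof.
apply: is_derive_row3.
by apply: (@is_derive_eq _ _ _ (fun s => r * sin th * cos s)); rewrite /GRing.scale/=; ring.
Qed.

Lemma radius_sphere_pt r th ps : 0 <= r -> radius (sphere_pt r th ps) = r.
Proof.
move=> r0; apply/eqP; rewrite -(@eqrXn2 _ 2)// ?sqrtr_ge0//; apply/eqP.
rewrite sphere_pt_row3 row3_radius.
have := cos2Dsin2 th; have := cos2Dsin2 ps.
move: (cos th) (sin th) (cos ps) (sin ps) => a b c d H1 H2.
transitivity (r ^+ 2 * (a ^+ 2 + b ^+ 2 * (c ^+ 2 + d ^+ 2))); first by ring.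
by rewrite H1 mulr1 H2 mulr1.
Qed.

Lemma radius_sphere_dth r th ps :
  radius (row3 (r * cos th * cos ps) (r * cos th * sin ps) (- (r * sin th))) ^+ 2
  = r ^+ 2.
Proof.
rewrite row3_radius; have := cos2Dsin2 th; have := cos2Dsin2 ps.
move: (cos th) (sin th) (cos ps) (sin ps) => a b c d H1 H2.
transitivity (r ^+ 2 * (a ^+ 2 * (c ^+ 2 + d ^+ 2) + b ^+ 2)); first by ring.
by rewrite H1 mulr1 H2 mulr1.
Qed.

(** The azimuthal tangent vector has Euclidean length r |sin th|. *)
Lemma radius_sphere_dps r th ps :
  radius (row3 (- (r * sin th * sin ps)) (r * sin th * cos ps) 0) ^+ 2 <= r ^+ 2.
Proof.
rewrite row3_radius; have := cos2Dsin2 th; have := cos2Dsin2 ps.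
move: (cos th) (sin th) (cos ps) (sin ps) => a b c d H1 H2.
have -> : (- (r * b * d)) ^+ 2 + (r * b * c) ^+ 2 + 0 ^+ 2 = (r * b) ^+ 2.
  by transitivity ((r * b) ^+ 2 * (c ^+ 2 + d ^+ 2)); [ring|rewrite H1 mulr1].
rewrite exprMn ler_piMr ?sqr_ge0// -H2 lerDr.
exact: sqr_ge0.
Qed.

End Sphere.

(** * The far zone *)

Section FarField.
Context {R : realType} (S : static_field R) (C K r1 : R).
Local Notation D := (sf_dom S).
Local Notation E := [set x : 'rV[R]_3 | r1 < radius x].
(** The factor 6 gives K / r <= 1/6 on [E]: over three dimensions the metric perturbation then costs
    at most 1/2, and |phi| stays well below 1. *)
Hypotheses (r1_gt0 : 0 < r1) (K_ge0 : 0 <= K) (Kr1 : 6 * K <= r1).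
Hypothesis hS : static_metric S.
Hypothesis ED : E `<=` D.
Hypothesis maj : forall x, D x -> expR (sf_omega S x) = (C + sf_phi S x) ^+ 2.
Hypothesis g_far : forall x i j, E x ->
  `|sf_g S x i j - (1%:M : 'M[R]_3) i j| <= K / radius x.
Hypothesis omega_far : forall x, E x ->
  `|1 - expR (sf_omega S x)| <= K / radius x.
Hypothesis phi_far : forall x, E x -> `|sf_phi S x| <= K / radius x.
Hypothesis dphi_far : forall x i, E x ->
  `|partial i (sf_phi S) x| <= K / radius x ^+ 2.

Let radius_gt0 x : E x -> 0 < radius x.
Proof. exact: lt_trans. Qed.

Let far_neq0 x : E x -> x != 0.
Proof.
apply: contraTneq => ->; rewrite /= -leNgt /radius big1 ?sqrtr0 ?ltW// => j _.
by rewrite mxE expr0n.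
Qed.

Let K_far x : E x -> K / radius x <= 6^-1.
Proof.
move=> Ex; rewrite ler_pdivrMr ?radius_gt0// mulrC ler_pdivlMr// mulrC.
by apply: le_trans Kr1 (ltW Ex).
Qed.

Let g_posdef x : E x -> posdef (sf_g S x).
Proof. by move=> /ED Dx; case: hS => _ _ _ _ /(_ x Dx). Qed.

(** The relative error 3 K / r is at most 1/2, so the form lies between 1/2 and 3/2 of the Euclidean
    one. *)
Lemma quad_form_far x v : E x ->
  2^-1 * radius v ^+ 2 <= (v *m sf_g S x *m v^T) 0 0 <= 2 * radius v ^+ 2.
Proof.
move=> Ex; have := @quad_form_close _ _ _ _ v (fun i j => g_far i j Ex).
move: (K / radius x) (K_far Ex) (sqr_ge0 (radius v)) => k k6.
move: (_ ^+ 2) => q q0 /ler_normlP[h1 h2].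
have : k * 3%:R * q <= 2^-1 * q by rewrite ler_wpM2r//; lra.
by move=> h3; apply/andP; split; lra.
Qed.

(** A [g]-unit vector has squared Euclidean length at most 2, by the lower bound of
    [quad_form_far]. *)
Lemma normal_far x i : E x -> `|normal S x 0 (lshift 1 i)| <= 2.
Proof.
move=> Ex; have x0 := far_neq0 Ex.
rewrite /normal row_mxEl; set w := _ *: _.
have /andP[wq _] := quad_form_far w Ex.
move: wq; rewrite (posdef_normalize (g_posdef Ex) x0) => wq.
apply: (le_trans (coord_le_radius w i)).
rewrite -(@ler_pXn2r _ 2)// ?nnegrE ?sqrtr_ge0//.
by lra.
Qed.

Lemma normal_flux_far x : E x -> `|normal_flux S x| <= 6 * K / radius x ^+ 2.
Proof.
move=> Ex; apply: (le_trans (ler_norm_sum _ _ _)).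
apply: (@le_trans _ _ (\sum_(i < 3) K / radius x ^+ 2 * 2)).
  by apply: ler_sum => i _; rewrite normrM ler_pM// ?dphi_far// normal_far.
by rewrite sumr_const card_ord le_eqVlt; apply/orP; left; apply/eqP; ring.
Qed.

(** Far out e^omega is close to 1 and phi to 0, so |C^2 - 1| = O(1/r); a positive value is
    contradicted at a point of large enough radius. *)
Lemma majumdar_constant : C ^+ 2 = 1.
Proof.
apply/eqP; rewrite -subr_eq0 -normr_eq0; apply/eqP.
set d := `| _ |; apply/eqP; rewrite eq_le normr_ge0 andbT leNgt; apply/negP => d0.
(* Beyond radius K (2 + 2 |C|) / d the bound on [d] proved below fails. *)
pose r := r1 + 1 + K * (2 + 2 * `|C|) / d.
have r0 : r1 < r.
  rewrite /r -addrA ltrDl ltr_pwDl//; apply: divr_ge0; last exact: ltW.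
  by apply: mulr_ge0 => //; apply: addr_ge0 => //; exact: mulr_ge0.
have rad : radius (sphere_pt r 0 0) = r.
  by apply: radius_sphere_pt; apply/ltW/(lt_trans r1_gt0).
have Ex : E (sphere_pt r 0 0) by rewrite /= rad.
have := omega_far Ex; have := phi_far Ex; have := K_far Ex.
rewrite maj; last exact: ED.
rewrite rad; move: (sf_phi _ _) => p k6 pk ok.
have : d <= K / r * (2 + 2 * `|C|).
  rewrite /d -normrN.
  (* The three pieces are at most K/r, 2 |C| K/r and K/r, the last because |p| <= 1. *)
  have -> : - (C ^+ 2 - 1) = (1 - (C + p) ^+ 2) + (2 * C * p + p * p) by ring.
  apply: (le_trans (ler_normD _ _)).
  have : `|2 * C * p + p * p| <= 2 * `|C| * (K / r) + (K / r).
    apply: (le_trans (ler_normD _ _)); apply: lerD.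
      by rewrite !normrM (@ger0_norm _ 2)// ler_wpM2l// mulr_ge0.
    rewrite normrM -[leRHS]mul1r ler_pM//.
    by apply: le_trans pk _; lra.
  by lra.
have rp : 0 < r by apply: lt_trans r0.
rewrite mulrAC ler_pdivlMr// /r !mulrDr mulrCA divff ?gt_eqF// mulr1.
have : 0 < d * r1 by rewrite mulr_gt0.
by lra.
Qed.

Lemma norm_majumdar_constant : `|C| = 1.
Proof.
by apply/eqP; rewrite -(@eqrXn2 _ 2)// -normrX majumdar_constant normr1 expr1n.
Qed.

Let potential_far x : E x -> `|C * sf_phi S x| <= 6^-1.
Proof.
move=> Ex.
by rewrite normrM norm_majumdar_constant mul1r (le_trans (phi_far Ex))// K_far.
Qed.

(* In the far zone [C + phi] has the sign of [C = 1 / C]. *)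
Lemma norm_potential x : E x -> `|C + sf_phi S x| = 1 + C * sf_phi S x.
Proof.
move=> Ex; rewrite -[LHS]mul1r -[X in X * _ = _]norm_majumdar_constant -normrM.
rewrite mulrDr -expr2 majumdar_constant ger0_norm//.
by have /ler_normlP[h1 h2] := potential_far Ex; lra.
Qed.

(** From C^2 = 1 follows C + phi = C (1 + C phi), so the sign factor of [majumdar_densities] is the
    constant [C]. *)
Lemma mass_density_far x : E x -> mass_density S x = C * normal_flux S x.
Proof.
move=> Ex; have [-> _] := majumdar_densities hS (posdef_unitmx (g_posdef Ex)) maj (ED Ex).
rewrite norm_potential//; congr (_ * _).
have /ler_normlP[h1 h2] := potential_far Ex.
have p0 : 1 + C * sf_phi S x != 0 by rewrite gt_eqF//; lra.
apply: (mulIf p0); rewrite mulfVK// mulrDr mulr1 mulrA -expr2 majumdar_constant.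
by rewrite mul1r.
Qed.

Lemma charge_density_far x : E x ->
  charge_density S x = normal_flux S x / (1 + C * sf_phi S x).
Proof.
move=> Ex; have [_ ->] := majumdar_densities hS (posdef_unitmx (g_posdef Ex)) maj (ED Ex).
by rewrite norm_potential.
Qed.

(** Each coordinate tangent vector has squared [g]-length at most 2 r^2, and [posdef_gram2] bounds
    the determinant by the product. *)
Lemma area_density_far r th ps : r1 < r -> `|area_density S r th ps| <= 2 * r ^+ 2.
Proof.
move=> r1r; have r0 : 0 <= r by apply/ltW/(lt_trans r1_gt0).
have Ex : E (sphere_pt r th ps) by rewrite /= radius_sphere_pt.
rewrite ger0_norm ?sqrtr_ge0// /area_density sphere_pt_dth sphere_pt_dps.
have -> : 2 * r ^+ 2 = Num.sqrt ((2 * r ^+ 2) ^+ 2).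
  by rewrite sqrtr_sqr ger0_norm// mulr_ge0// sqr_ge0.
apply: ler_wsqrtr; apply: (le_trans (posdef_gram2 _ _ (g_posdef Ex))).
have g0 v := posdef_ge0 v (g_posdef Ex).
rewrite expr2; apply: ler_pM => //.
  have /andP[_ /le_trans] := quad_form_far
   (row3 (r * cos th * cos ps) (r * cos th * sin ps) (- (r * sin th))) Ex.
  by apply; rewrite radius_sphere_dth.
have /andP[_ /le_trans] := quad_form_far
   (row3 (- (r * sin th * sin ps)) (r * sin th * cos ps) 0) Ex.
by apply; rewrite ler_wpM2l// radius_sphere_dps.
Qed.

(** * Continuity of the two integrands in the angles *)

Section Continuity.
(** An arbitrary map [u] into the far zone covers both the case of a moving polar angle and that of
    a moving azimuth. *)
Context (T : topologicalType) (t : T) (u : T -> 'rV[R]_3).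
Hypothesis (uE : forall s, E (u s)) (cu : mx_continuous_at t u).

Let continuous_far (f : 'rV[R]_3 -> R) :
  (forall x, D x -> {for x, continuous f}) -> {for t, continuous (fun s => f (u s))}.
Proof.
move=> cf; apply: (@continuous_comp _ _ _ u f); first exact: mx_continuous_cvg.
by apply: cf; exact: ED.
Qed.

Lemma potential_continuous : {for t, continuous (fun s => sf_phi S (u s))}.
Proof. by apply: continuous_far; case: hS => _ _ _ []. Qed.

Lemma g_continuous : mx_continuous_at t (fun s => sf_g S (u s)).
Proof.
move=> i j; apply: (@continuous_far (fun x => sf_g S x i j)).
by case: hS => _ /(_ i j)[].
Qed.

Lemma normal_flux_continuous : {for t, continuous (fun s => normal_flux S (u s))}.
Proof.
have cgi : mx_continuous_at t (fun s => invmx (sf_g S (u s))).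
  by apply: mx_continuous_inv g_continuous => s; exact/posdef_unitmx/g_posdef.
apply: continuous_at_sum => i; apply: cvgM.
  apply: (@continuous_far (partial i (sf_phi S))).
  by case: hS => _ _ _ [_ /(_ i)[_ []]].
under eq_cvg do rewrite /normal row_mxEl mxE.
rewrite /normal row_mxEl mxE.
apply: cvgM; last first.
  exact: (mx_continuous_mul cu (mx_continuous_tr cgi)).
apply: cvgV; last first.
  apply: (@continuous_comp _ _ _ (fun s => (u s *m invmx (sf_g S (u s)) *m (u s)^T) 0 0)).
    exact: (mx_continuous_mul (mx_continuous_mul cu cgi) (mx_continuous_tr cu)).
  exact: sqrt_continuous.
(* The normalizing root is nonzero because the inverse metric is positive definite and far points
   are nonzero. *)
rewrite gt_eqF// sqrtr_gt0; apply: (posdef_inv (g_posdef (uE t))).2.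
exact: far_neq0.
Qed.

End Continuity.

Section SphereContinuity.
Context (r : R) (T : topologicalType) (t : T) (th ps : T -> R).
Hypotheses (r1r : r1 < r) (cth : {for t, continuous th}) (cps : {for t, continuous ps}).
Local Notation p := (fun s => sphere_pt r (th s) (ps s)).

Let csin (a : T -> R) : {for t, continuous a} -> {for t, continuous (fun s => sin (a s))}.
Proof. by move=> ca; apply: (continuous_comp ca); exact: continuous_sin. Qed.

Let ccos (a : T -> R) : {for t, continuous a} -> {for t, continuous (fun s => cos (a s))}.
Proof. by move=> ca; apply: (continuous_comp ca); exact: continuous_cos. Qed.

Let crmul (a b : T -> R) : {for t, continuous a} -> {for t, continuous b} ->
  {for t, continuous (fun s => r * a s * b s)}.
Proof. by move=> ca cb; apply: cvgM cb; apply: cvgM ca; exact: cvg_cst. Qed.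

Let pE s : E (p s).
Proof. by rewrite /= radius_sphere_pt//; apply/ltW/(lt_trans r1_gt0). Qed.

Let cp : mx_continuous_at t p.
Proof.
apply: row3_continuous.
- by apply: crmul; [exact: csin|exact: ccos].
- by apply: crmul; [exact: csin|exact: csin].
- by apply: cvgM; [exact: cvg_cst|exact: ccos].
Qed.

(** The matrix [J] of [area_density] with its derivatives computed, so that continuity can be read
    off the entries. *)
Let tangents s : 'M[R]_(1 + 1, 3) := col_mx
  (row3 (r * cos (th s) * cos (ps s)) (r * cos (th s) * sin (ps s)) (- (r * sin (th s))))
  (row3 (- (r * sin (th s) * sin (ps s))) (r * sin (th s) * cos (ps s)) 0).

Let ctangents : mx_continuous_at t tangents.
Proof.
apply: mx_continuous_col; apply: row3_continuous.
- by apply: crmul; exact: ccos.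
- by apply: crmul; [exact: ccos|exact: csin].
- by apply: cvgN; apply: cvgM; [exact: cvg_cst|exact: csin].
- by apply: cvgN; apply: crmul; exact: csin.
- by apply: crmul; [exact: csin|exact: ccos].
- exact: cvg_cst.
Qed.

Let carea : {for t, continuous (fun s => area_density S r (th s) (ps s))}.
Proof.
have -> : (fun s => area_density S r (th s) (ps s)) =
    Num.sqrt \o fun s => \det (tangents s *m sf_g S (p s) *m (tangents s)^T).
  by apply/funext => s; rewrite /area_density sphere_pt_dth sphere_pt_dps.
apply: continuous_comp; last exact: sqrt_continuous.
apply: mx_continuous_det; apply: mx_continuous_mul; last exact: mx_continuous_tr.
by apply: mx_continuous_mul => //; exact: g_continuous.
Qed.

Lemma mass_integrand_continuous : {for t, continuous (fun s =>
  mass_density S (p s) * area_density S r (th s) (ps s))}.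
Proof.
apply: cvgM carea.
have -> : (fun s => mass_density S (p s)) = fun s => C * normal_flux S (p s).
  by apply/funext => s; rewrite mass_density_far.
rewrite mass_density_far//.
by apply: cvgM; [exact: cvg_cst|exact: (normal_flux_continuous pE cp)].
Qed.

Lemma charge_integrand_continuous : {for t, continuous (fun s =>
  charge_density S (p s) * area_density S r (th s) (ps s))}.
Proof.
apply: cvgM carea.
have -> : (fun s => charge_density S (p s)) = fun s =>
    normal_flux S (p s) / (1 + C * sf_phi S (p s)).
  by apply/funext => s; rewrite charge_density_far.
rewrite charge_density_far//.
apply: cvgM; first exact: (normal_flux_continuous pE cp).
apply: cvgV.
  by have /ler_normlP[h1 h2] := potential_far (pE t); rewrite gt_eqF//; lra.
apply: cvgD; first exact: cvg_cst.
by apply: cvgM; [exact: cvg_cst|exact: (potential_continuous pE cp)].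
Qed.

End SphereContinuity.

(** The r^-2 decay of the flux cancels the r^2 growth of the area, leaving a bound independent of
    [r]. *)
Lemma normal_flux_area_far r th ps : r1 < r ->
  `|normal_flux S (sphere_pt r th ps)| * `|area_density S r th ps| <= 12 * K.
Proof.
move=> r1r; have r0 : 0 < r := lt_trans r1_gt0 r1r.
have rad : radius (sphere_pt r th ps) = r by rewrite radius_sphere_pt// ltW.
have Ex : E (sphere_pt r th ps) by rewrite /= rad.
apply: (@le_trans _ _ (6 * K / r ^+ 2 * (2 * r ^+ 2))).
  by apply: ler_pM => //; [rewrite -{2}rad normal_flux_far|exact: area_density_far].
have r20 : r ^+ 2 != 0 by rewrite expf_neq0// gt_eqF.
by rewrite mulrCA divfK// mulrA le_eqVlt; apply/orP; left; apply/eqP; ring.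
Qed.

Lemma sphere_integrals_close r : r1 < r ->
  `|sphere_integral S r (mass_density S) - C * sphere_integral S r (charge_density S)|
  <= 24 * K ^+ 2 / r * (2 * pi) * pi.
Proof.
move=> r1r; have r0 : 0 < r := lt_trans r1_gt0 r1r.
have rad th ps : radius (sphere_pt r th ps) = r by rewrite radius_sphere_pt// ltW.
have Ex th ps : E (sphere_pt r th ps) by rewrite /= rad.
(* As |C phi| <= 1/6, the denominator is at least 5/6. *)
have lapse_inv x : E x -> 0 < (1 + C * sf_phi S x)^-1 <= 2.
  move=> Fx; have /ler_normlP[h1 h2] := potential_far Fx.
  have h0 : 0 < 1 + C * sf_phi S x by lra.
  by rewrite invr_gt0 h0/= -[leRHS]invrK lef_pV2 ?posrE ?invr_gt0//; lra.
have p0 : 0 <= (pi : R) := pi_ge0 R.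
have p2 : 0 <= 2 * (pi : R) by rewrite mulr_ge0.
rewrite -[X in _ * X * _]subr0 -[X in _ <= _ * _ * X]subr0.
(* The bound 24 K covers both integrands: 12 K for the mass, and 12 K times the factor 2 of
   [lapse_inv] for the charge. *)
apply: (@iterated_Rintegral_close _ _ _ C 0 pi 0 (2 * pi) (24 * K)) => //.
- by split=> u v; apply: mass_integrand_continuous => //;
    first [exact: cvg_cst|exact: cvg_id].
- by split=> u v; apply: charge_integrand_continuous => //;
    first [exact: cvg_cst|exact: cvg_id].
- move=> th ps; rewrite mass_density_far// !normrM norm_majumdar_constant mul1r.
  apply: (le_trans (normal_flux_area_far th ps r1r)).
  by rewrite ler_wpM2r// ler_nat.
- move=> th ps; rewrite charge_density_far// !normrM mulrAC.
  have /andP[l0 l2] := lapse_inv _ (Ex th ps).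
  have -> : 24 * K = 12 * K * 2 by ring.
  apply: ler_pM => //; first exact: normal_flux_area_far.
  by rewrite gtr0_norm.
- move=> th ps; rewrite mass_density_far// charge_density_far//.
  have /andP[l0 l2] := lapse_inv _ (Ex th ps).
  have ph : `|sf_phi S (sphere_pt r th ps)| <= K / r.
    by rewrite -{2}(rad th ps); exact: phi_far.
  have := normal_flux_area_far th ps r1r.
  move: (normal_flux _ _) (area_density _ _ _ _) => h a ha.
  have l1 : (1 + C * sf_phi S (sphere_pt r th ps)) != 0.
    by rewrite -invr_eq0 gt_eqF.
  (* Subtracting exposes the extra factor phi = O(1/r) that makes the difference of the integrals
     vanish in the limit. *)
  have -> : C * h * a - C * (h / (1 + C * sf_phi S (sphere_pt r th ps)) * a) =
      C ^+ 2 * (h * a) *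
      (sf_phi S (sphere_pt r th ps) * (1 + C * sf_phi S (sphere_pt r th ps))^-1).
    by field.
  rewrite majumdar_constant mul1r !normrM (gtr0_norm l0).
  have -> : 24 * K ^+ 2 / r = 12 * K * (K / r * 2) by ring.
  by apply: ler_pM => //; [rewrite mulr_ge0// ltW|exact: (ler_pM _ (ltW l0) ph l2)].
Qed.

(** The difference of the normalized integrals tends to m - C q, and also to 0 by
    [sphere_integrals_close]. *)
Lemma total_mass_charge m q : is_total_mass S m -> is_total_charge S q -> m = C * q.
Proof.
rewrite /is_total_mass /is_total_charge => hm hq.
have hd : (4 * pi)^-1 * sphere_integral S r (mass_density S)
    - C * ((4 * pi)^-1 * sphere_integral S r (charge_density S)) @[r --> +oo]
    --> m - C * q.
  by apply: cvgB hm _; apply: cvgM hq; exact: cvg_cst.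
apply/eqP; rewrite -subr_eq0; apply/eqP; apply: (norm_cvg_unique hd).
apply/cvgr0Pnorm_le => e e0.
(* The normalized bound of [sphere_integrals_close] is B / r, hence at most [e] once r >= B / e. *)
pose B : R := (4 * pi)^-1 * (24 * K ^+ 2 * (2 * pi) * pi).
have pi0 := pi_gt0 R.
near=> r.
have r1r : r1 < r by near: r; apply: nbhs_pinfty_gt; exact: num_real.
have rB : B / e <= r by near: r; apply: nbhs_pinfty_ge; exact: num_real.
have r0 : 0 < r := lt_trans r1_gt0 r1r.
rewrite mulrCA -mulrBr normrM gtr0_norm; last by rewrite invr_gt0 mulr_gt0.
apply: (@le_trans _ _ (B / r)); last by rewrite ler_pdivrMr// mulrC -ler_pdivrMr.
have -> : B / r = (4 * pi)^-1 * (24 * K ^+ 2 / r * (2 * pi) * pi).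
  by rewrite /B; ring.
rewrite ler_wpM2l ?sphere_integrals_close//.
by rewrite invr_ge0 mulr_ge0// ltW.
Unshelve. all: by end_near. Qed.

End FarField.

(** * From asymptotic flatness to the far-zone bounds, and the conclusion *)

Theorem mainTheorem4 (R : realType) (S : static_field R) (m q : R)
  (hS : static_electrogravitational S)
  (hflat : asymptotically_flat S)
  (hmaj : majumdar_type S)
  (hm : is_total_mass S m)
  (hq : is_total_charge S q) :
  `|m| = `|q| /\ (0 <= m -> m = `|q|).
Proof.
case: hS hflat hmaj => hS _ [[r0 r0D] hmet _ hphi hdphi] [C maj].
have [K1 [r1 [K10 r10 H1]]] := @falloff_uniform _ _ _ 1
  (fun ij : 'I_(3 + 1) * 'I_(3 + 1) => fun x =>
     metric S (at_rest x) ij.1 ij.2 - Defs.minkowski ij.1 ij.2)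
  (fun ij => hmet ij.1 ij.2).
have [K2 [r2 [K20 r20 H2]]] := @falloff_uniform _ _ _ 1
  (fun _ : unit => sf_phi S) (fun=> hphi).
have [K3 [r3 [K30 r30 H3]]] := @falloff_uniform _ _ _ 2 _ hdphi.
(* One constant and one radius serve all the bounds; the summand 6 K secures the smallness condition
   of the far zone, and |r0| appears because the chart radius carries no sign. *)
pose K := K1 + K2 + K3; pose r : R := `|r0| + r1 + r2 + r3 + 6 * K.
have K0 : 0 <= K by rewrite !addr_ge0.
have r0' : 0 <= `|r0| by [].
have r0r : r0 <= `|r0| := ler_norm r0.
have far (x : 'rV[R]_3) : r < radius x ->
    [/\ 0 < radius x, r0 < radius x, r1 < radius x, r2 < radius x & r3 < radius x].
  by rewrite /r => rx; split; lra.
have weaken (x : 'rV[R]_3) k K' :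
    r < radius x -> K' <= K -> K' / radius x ^+ k <= K / radius x ^+ k.
  move=> /far[rx _ _ _ _] KK.
  by rewrite ler_wpM2r// invr_ge0 exprn_ge0// ltW.
have [-> C1] : m = C * q /\ `|C| = 1.
  have rp : 0 < r by rewrite /r; lra.
  have Kr : 6 * K <= r by rewrite /r; lra.
  have ED : [set x : 'rV[R]_3 | r < radius x] `<=` sf_dom S.
    by move=> x /far[_ ? _ _ _]; exact: r0D.
  have gf x i j : r < radius x ->
      `|sf_g S x i j - (1%:M : 'M[R]_3) i j| <= K / radius x.
    move=> rx; have [_ _ r1x _ _] := far x rx.
    have := H1 (lshift 1 i, lshift 1 j) x r1x.
    rewrite /= /metric /Defs.minkowski !block_mxEul space_of_at_rest => /le_trans; apply.
    by have := weaken x 1 K1 rx; rewrite expr1; apply; rewrite /K; lra.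
  have omf x : r < radius x -> `|1 - expR (sf_omega S x)| <= K / radius x.
    move=> rx; have [_ _ r1x _ _] := far x rx.
    have := H1 (time_idx, time_idx) x r1x.
    rewrite /= metric_time_time /Defs.minkowski block_mxEdr mxE eqxx mulr1n opprK.
    rewrite space_of_at_rest addrC => /le_trans; apply.
    by have := weaken x 1 K1 rx; rewrite expr1; apply; rewrite /K; lra.
  have phf x : r < radius x -> `|sf_phi S x| <= K / radius x.
    move=> rx; have [_ _ _ r2x _] := far x rx.
    apply: (le_trans (H2 tt x r2x)).
    by have := weaken x 1 K2 rx; rewrite expr1; apply; rewrite /K; lra.
  have dphf x i : r < radius x -> `|partial i (sf_phi S) x| <= K / radius x ^+ 2.
    move=> rx; have [_ _ _ _ r3x] := far x rx.
    apply: (le_trans (H3 i x r3x)).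
    by apply: weaken => //; rewrite /K; lra.
  split; last exact: (@norm_majumdar_constant _ S C K r).
  exact: (@total_mass_charge _ S C K r).
(* The relation m = C q with |C| = 1 equates absolute values and leaves the sign of [m] open; the
   second claim takes it from [0 <= m]. *)
by rewrite normrM C1 mul1r; split=> // /ger0_norm <-; rewrite normrM C1 mul1r.
Qed.
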